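(* For each integer $d\ge 0$ the Catalan Pell numbers $\mathcal S^{(d)}_n$, $n\ge 0$, are given by the generating function $$\mathcal S^{(d)}(x)=\sum_{n\ge 0}\mathcal S^{(d)}_n x^n=\Bigl(1-2x-\sum_{k=1}^{d-1}C_k x^{k+1}\Bigr)^{-1}.$$ Moreover, $\mathcal S^{(1)}_n=2^n$ for all $n$; $(\mathcal S^{(2)}_n)_n=(P_{n+1})_n$ is the sequence of Pell numbers; and $\lim_{d\to\infty}(\mathcal S^{(d)}_n)_n=(C_{n+1})_n$, i.e. $\lim_{d\to\infty}\mathcal S^{(d)}_n=C_{n+1}$ for each $n$.
   Context: $C_n=\frac{1}{n+1}\binom{2n}{n}$ is the $n$-th Catalan number. The Pell numbers are defined by $P_0=0$, $P_1=1$, $P_n=2P_{n-1}+P_{n-2}$. For integers $d,n\ge0$ the Catalan Pell numbers $\mathcal S^{(d)}_n$ are defined by the initial conditions $\mathcal S^{(d)}_n=C_{n+1}$ for $0\le n\le d$ and the recursion $\mathcal S^{(d)}_n=2\mathcal S^{(d)}_{n-1}+\sum_{k=1}^{d-1}C_k\,\mathcal S^{(d)}_{n-k-1}$ for $n>d$ (empty sums are $0$). *)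

(* Defs.v *)
From HB Require Import structures.
From mathcomp Require Import all_boot all_order all_algebra.
From mathcomp Require Import boolp.
Set Implicit Arguments.
Unset Strict Implicit.
Unset Printing Implicit Defensive.
Import GRing.Theory.
Local Open Scope ring_scope.

(* fps R is R[[x]]; a series is a unit iff its constant coefficient is a unit. *)

Record fps (R : Type) : Type := Fps { fpscoef : nat -> R }.

HB.instance Definition _ (R : Type) := gen_eqMixin (fps R).
HB.instance Definition _ (R : Type) := gen_choiceMixin (fps R).

Lemma fpsP (R : Type) (a b : fps R) : fpscoef a =1 fpscoef b -> a = b.
Proof. by case: a b => [a] [b] /= /funext->. Qed.

Section FpsZmod.
Variable R : zmodType.
Implicit Types a b c : fps R.

Definition fps_zero : fps R := Fps (fun=> 0).
Definition fps_opp a : fps R := Fps (fun n => - fpscoef a n).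
Definition fps_add a b : fps R := Fps (fun n => fpscoef a n + fpscoef b n).

Fact fps_addA : associative fps_add.
Proof. by move=> a b c; apply: fpsP => n /=; rewrite addrA. Qed.
Fact fps_addC : commutative fps_add.
Proof. by move=> a b; apply: fpsP => n /=; rewrite addrC. Qed.
Fact fps_add0 : left_id fps_zero fps_add.
Proof. by move=> a; apply: fpsP => n /=; rewrite add0r. Qed.
Fact fps_addN : left_inverse fps_zero fps_opp fps_add.
Proof. by move=> a; apply: fpsP => n /=; rewrite addNr. Qed.

HB.instance Definition _ :=
  GRing.isZmodule.Build (fps R) fps_addA fps_addC fps_add0 fps_addN.

End FpsZmod.

Section FpsRing.
Variable R : comNzRingType.
Implicit Types a b c : fps R.

Definition fps_one : fps R := Fps (fun n => (n == 0%N)%:R).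
Definition fps_mul a b : fps R :=
  Fps (fun n => \sum_(i < n.+1) fpscoef a i * fpscoef b (n - i)%N).

Let trunc m a : {poly R} := \poly_(i < m) fpscoef a i.

Let coef_trunc m a i : (i < m)%N -> (trunc m a)`_i = fpscoef a i.
Proof. by rewrite coef_poly => ->. Qed.

Let mulE m a b n : (n < m)%N ->
  fpscoef (fps_mul a b) n = (trunc m a * trunc m b)`_n.
Proof.
move=> nm; rewrite coefM; apply: eq_bigr => i _.
by rewrite !coef_trunc // ?(leq_ltn_trans (leq_subr _ _)) //
  (leq_ltn_trans _ nm) // -ltnS.
Qed.

Fact fps_mulA : associative fps_mul.
Proof.
move=> a b c; apply: fpsP => n.
have -> : fpscoef (fps_mul a (fps_mul b c)) n
          = (trunc n.+1 a * (trunc n.+1 b * trunc n.+1 c))`_n.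
  rewrite coefM; apply: eq_bigr => i _; rewrite coef_trunc //; congr (_ * _).
  by apply: mulE; rewrite ltnS leq_subr.
rewrite mulrA coefM; apply: eq_bigr => i _.
by rewrite -(@mulE n.+1) // (@coef_trunc n.+1 c) // ltnS leq_subr.
Qed.
Fact fps_mulC : commutative fps_mul.
Proof.
by move=> a b; apply: fpsP => n; rewrite !(@mulE n.+1) // mulrC.
Qed.
Fact fps_mul1 : left_id fps_one fps_mul.
Proof.
move=> a; apply: fpsP => n /=; rewrite big_ord_recl /= mul1r subn0.
by rewrite big1 ?addr0 // => i _; rewrite mul0r.
Qed.
Fact fps_mulDl : left_distributive fps_mul (@fps_add R).
Proof.
move=> a b c; apply: fpsP => n /=; rewrite -big_split /=.
by apply: eq_bigr => i _; rewrite mulrDl.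
Qed.
Fact fps_one_neq0 : fps_one != 0 :> fps R.
Proof.
apply/eqP => /(congr1 (fun a => fpscoef a 0)) /= /eqP.
by rewrite (negPf (oner_neq0 R)).
Qed.

HB.instance Definition _ := GRing.Zmodule_isComNzRing.Build (fps R)
  fps_mulA fps_mulC fps_mul1 fps_mulDl fps_one_neq0.

Definition fpsX : fps R := Fps (fun n => (n == 1%N)%:R).

Lemma fpscoefM a b n :
  fpscoef (a * b) n = \sum_(i < n.+1) fpscoef a i * fpscoef b (n - i)%N.
Proof. by []. Qed.

End FpsRing.

Arguments fpsX {R}.

Section FpsUnit.
Variable R : comUnitRingType.
Implicit Types a b : fps R.

Definition fps_unit : {pred fps R} :=
  fun a => fpscoef a 0 \in GRing.unit.

(* The first n coefficients of the inverse of a, obtained by solving          *)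
(* a * b = 1 degree by degree.                                                *)
Fixpoint fps_inv_prefix a n : seq R :=
  if n is m.+1 then
    let s := fps_inv_prefix a m in
    rcons s ((fpscoef a 0)^-1 *
             ((m == 0%N)%:R - \sum_(i < m) s`_i * fpscoef a (m - i)%N))
  else [::].

Definition fps_inv a : fps R :=
  if a \in fps_unit then Fps (fun n => (fps_inv_prefix a n.+1)`_n) else a.

Let size_prefix a n : size (fps_inv_prefix a n) = n.
Proof. by elim: n => //= n IH; rewrite size_rcons IH. Qed.

Let nth_prefix a n i : (i < n)%N ->
  (fps_inv_prefix a n)`_i = (fps_inv_prefix a i.+1)`_i.
Proof.
elim: n => // n IH; rewrite ltnS leq_eqVlt => /predU1P[->//|lt_in].
by rewrite -IH // [LHS]/= nth_rcons size_prefix lt_in.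
Qed.

Fact fps_mulVx : {in fps_unit, left_inverse 1 fps_inv *%R}.
Proof.
move=> a ua; apply: fpsP => n; rewrite /fps_inv ua fpscoefM /=.
rewrite big_ord_recr /= subnn nth_rcons size_prefix ltnn eqxx.
rewrite mulrAC mulVr // mul1r addrC -[RHS]addr0 -addrA; congr (_ + _).
rewrite addrC; apply/eqP; rewrite subr_eq0; apply/eqP; apply: eq_bigr => i _.
by rewrite [in RHS]nth_prefix.
Qed.

Fact fps_unitPl a b : b * a = 1 -> fps_unit a.
Proof.
move=> /(congr1 (fun c => fpscoef c 0)).
rewrite fpscoefM big_ord_recl big_ord0 addr0 /= => ba1.
by apply/unitrPr; exists (fpscoef b 0); rewrite mulrC.
Qed.

Fact fps_inv_out : {in [predC fps_unit], fps_inv =1 id}.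
Proof. by move=> a; rewrite inE /= /fps_inv => /negPf->. Qed.

HB.instance Definition _ := GRing.ComNzRing_hasMulInverse.Build (fps R)
  fps_mulVx fps_unitPl fps_inv_out.

Lemma fps_unitE a : (a \is a GRing.unit) = (fpscoef a 0 \is a GRing.unit).
Proof. by []. Qed.

End FpsUnit.

Definition genfun (u : nat -> nat) : fps int := Fps (fun n => (u n)%:Z).

Local Open Scope nat_scope.

Definition catalan (n : nat) : nat := 'C(2 * n, n) %/ n.+1.

Lemma catalanK n : catalan n * n.+1 = 'C(2 * n, n).
Proof.
apply: divnK; have E := mul_bin_left (2 * n) n.
have e : 2 * n - n = n by rewrite mul2n -addnn addnK.
rewrite e in E.
by rewrite -(@Gauss_dvdr _ n) ?coprimeSn // -E dvdn_mulr.
Qed.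

Fixpoint pell (n : nat) : nat :=
  match n with
  | 0 => 0
  | 1 => 1
  | (m.+1 as p).+1 => 2 * pell p + pell m
  end.

(* The first n values of the sequence, so that the recursion can refer to all *)
(* earlier values.                                                            *)
Fixpoint catalan_pell_prefix (d n : nat) : seq nat :=
  if n is m.+1 then
    let s := catalan_pell_prefix d m in
    rcons s (if m <= d then catalan m.+1 else
             2 * nth 0 s (m - 1) +
             \sum_(1 <= k < d) catalan k * nth 0 s (m - k - 1))
  else [::].

Definition catalan_pell (d n : nat) : nat :=
  nth 0 (catalan_pell_prefix d n.+1) n.

Lemma size_catalan_pell_prefix d n : size (catalan_pell_prefix d n) = n.
Proof. by elim: n => //= n IH; rewrite size_rcons IH. Qed.

Lemma nth_catalan_pell_prefix d n i : i < n ->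
  nth 0 (catalan_pell_prefix d n) i = catalan_pell d i.
Proof.
elim: n => // n IH; rewrite ltnS leq_eqVlt => /predU1P[->//|lt_in].
by rewrite -IH // [LHS]/= nth_rcons size_catalan_pell_prefix lt_in.
Qed.

Lemma catalan_pell_init d n : n <= d -> catalan_pell d n = catalan n.+1.
Proof.
move=> nd; rewrite /catalan_pell /= nth_rcons size_catalan_pell_prefix.
by rewrite ltnn eqxx nd.
Qed.

Lemma catalan_pell_rec d n : d < n ->
  catalan_pell d n = 2 * catalan_pell d (n - 1) +
    \sum_(1 <= k < d) catalan k * catalan_pell d (n - k - 1).
Proof.
move=> dn; have n0 : 0 < n by exact: leq_ltn_trans dn.
rewrite {1}/catalan_pell /= nth_rcons size_catalan_pell_prefix.
rewrite ltnn eqxx leqNgt dn /= nth_catalan_pell_prefix; last first.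
  by rewrite subn1 prednK.
congr (_ + _); apply: eq_big_nat => k _.
by rewrite nth_catalan_pell_prefix // -subnDA addn1 ltn_subrL.
Qed.

(* Main.v *)
Require Import Defs.
From mathcomp Require Import all_boot all_order all_algebra.
From mathcomp Require Import all_classical all_reals all_analysis.
From mathcomp Require Import zify.
Import GRing.Theory numFieldNormedType.Exports.
Local Open Scope classical_set_scope.
Local Open Scope ring_scope.

(** The power series identity says that the Catalan Pell numbers satisfy, for
    every n,
      S_{n+1} = 2 S_n + sum_{1 <= k < d, k <= n} C_k S_{n-k},
    together with S_0 = 1; this is what comparing the coefficients of
    S(x) (1 - 2x - sum_k C_k x^{k+1}) and 1 gives.  For n + 1 > d it is the
    defining recursion.  For n + 1 <= d all the values involved are Catalan
    numbers, and it becomes Segner's convolution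
    C_{n+2} = sum_{k <= n+1} C_k C_{n+1-k}, whose two extreme terms make up the
    summand 2 S_n = 2 C_{n+1}.  Thus [catalan_pell_recS] rests on
    [catalan_segner], which is derived from the closed formula for the Catalan
    numbers.

    The cases d = 1 and d = 2 are immediate from this recursion, and the limit
    holds because S^(d)_n = C_{n+1} as soon as d >= n. *)

(** Passing from the binomial coefficient (2n over n) to (2n+2 over n+1) through
    (2n+1 over n) costs the factors (2n+1)/(n+1) and 2; [catalanK] translates
    this to Catalan numbers. *)
Lemma catalanS (n : nat) :
  (n.+2 * catalan n.+1 = 2 * (2 * n).+1 * catalan n)%N.
Proof.
have F1 := mul_bin_diag (2 * n).+2 n.
have F2 := mul_bin_down (2 * n).+1 n.
have e1 : (2 * n.+1 = (2 * n).+2)%N by lia.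
have e2 : ((2 * n).+1 - n = n.+1)%N by lia.
rewrite e2 /= in F1 F2.
apply/eqP; rewrite -(eqn_pmul2l (ltn0Sn n)); apply/eqP.
rewrite (mulnC n.+2) catalanK e1 -F1.
have -> : ((2 * n).+2 * 'C((2 * n).+1, n) = 2 * (n.+1 * 'C((2 * n).+1, n)))%N.
  by lia.
by rewrite -F2 -catalanK; lia.
Qed.

(** Average the weighted sum with its image under the reversal k |-> n - k: the
    weights k + 1 and n - k + 1 add up to n + 2. *)
Lemma convolution_weight (u : nat -> nat) (n : nat) :
  (2 * (\sum_(k < n.+1) k.+1 * (u k * u (n - k))) =
   n.+2 * \sum_(k < n.+1) u k * u (n - k))%N.
Proof.
rewrite mul2n -addnn {1}(reindex_inj rev_ord_inj) /= -big_split big_distrr /=.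
apply: eq_bigr => -[k /= kn] _; rewrite subSS subKn // (mulnC (u (n - k)%N)).
by rewrite -mulnDl; congr (_ * _)%N; lia.
Qed.

(** Induction on n. In the sum of (k + 1) C_k C_{n+1-k}, the factor (k + 1) C_k
    of each term with k > 0 is 2 (2k - 1) C_{k-1} by [catalanS], which expresses
    this sum through the convolutions at n. Since [convolution_weight] relates
    the weighted sums to the unweighted ones, the value C_{n+1} of the convolution
    at n determines its value at n + 1. *)
Lemma catalan_segner (n : nat) :
  (catalan n.+1 = \sum_(k < n.+1) catalan k * catalan (n - k))%N.
Proof.
elim: n => [|n IHn]; first by rewrite big_ord1.
have W1 := convolution_weight catalan n.+1.
have W0 := convolution_weight catalan n.
have step : (\sum_(k < n.+1) k.+2 * (catalan k.+1 * catalan (n - k)) +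
    2 * \sum_(k < n.+1) catalan k * catalan (n - k) =
    4 * \sum_(k < n.+1) k.+1 * (catalan k * catalan (n - k)))%N.
  rewrite !big_distrr -big_split /=; apply: eq_bigr => k _.
  by rewrite mulnA catalanS; lia.
have peel : (\sum_(k < n.+2) k.+1 * (catalan k * catalan (n.+1 - k)) =
    catalan n.+1 + \sum_(k < n.+1) k.+2 * (catalan k.+1 * catalan (n - k)))%N.
  by rewrite big_ord_recl subn0 !mul1n.
rewrite -IHn in W0 step.
have R1 := catalanS n.+1.
rewrite peel in W1.
set A := (\sum_(k < n.+2) _)%N in W1 *.
(* Both sides equal 2 (2n + 3) C_{n+1}. *)
apply/eqP; rewrite -(eqn_pmul2l (ltn0Sn n.+2)); apply/eqP.
by nia.
Qed.

Lemma catalan_pell0 (d : nat) : catalan_pell d 0 = 1%N.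
Proof. by rewrite catalan_pell_init. Qed.

(** The condition k <= n is what makes a single recursion hold in the initial
    range as well, where it is Segner's recurrence. *)
Lemma catalan_pell_recS (d n : nat) :
  (catalan_pell d n.+1 = 2 * catalan_pell d n +
   \sum_(1 <= k < d | k <= n) catalan k * catalan_pell d (n - k))%N.
Proof.
have [dn|nd] := ltnP d n.+1.
  rewrite catalan_pell_rec // subn1; congr (_ + _)%N.
  rewrite [in RHS]big_nat_cond [in LHS]big_nat_cond.
  apply: eq_big => [k|k _]; first by apply/idP/idP; lia.
  by congr (_ * catalan_pell _ _)%N; lia.
(* The terms with n < k drop out, so k effectively ranges over [1, n]. *)
rewrite !catalan_pell_init ?(ltnW nd) //.
rewrite (big_cat_nat (n := n.+1)) //= [X in (_ + (_ + X))%N]big1_seq ?addn0;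
  last first.
  by move=> k; rewrite mem_index_iota => /andP[kn /andP[nk _]]; lia.
have -> : (\sum_(1 <= k < n.+1 | k <= n) catalan k * catalan_pell d (n - k) =
    \sum_(k < n) catalan k.+1 * catalan (n - k))%N.
  rewrite big_add1 big_mkord; apply: eq_big => [[k kn] //|[k /= kn] _].
  rewrite catalan_pell_init; first by rewrite -subSn.
  by rewrite (leq_trans (leq_subr _ _)) // ltnW.
rewrite catalan_segner big_ord_recl big_ord_recr /= subn0 subnn.
have -> : catalan 0 = 1%N by [].
by rewrite mul1n muln1 addnCA addnC mul2n -addnn.
Qed.

Lemma fpscoefXnM (R : comNzRingType) (a : fps R) (k n : nat) :
  fpscoef (fpsX ^+ k * a) n = if (k <= n)%N then fpscoef a (n - k)%N else 0.
Proof.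
elim: k n => [|k IHk] n; first by rewrite expr0 mul1r subn0.
rewrite exprS -mulrA fpscoefM.
case: n => [|n]; first by rewrite big_ord1 mul0r.
rewrite 2!big_ord_recl [X in _ + (_ + X)]big1; last first.
  by move=> i _; rewrite mul0r.
by rewrite mul0r add0r mul1r addr0 subn1 IHk.
Qed.

Lemma fpscoef_sum (R : zmodType) (I : Type) (r : seq I) (P : pred I)
    (F : I -> fps R) (n : nat) :
  fpscoef (\sum_(i <- r | P i) F i) n = \sum_(i <- r | P i) fpscoef (F i) n.
Proof. exact: (big_morph (fun a : fps R => fpscoef a n)). Qed.

Lemma fpscoef_natMl (R : comNzRingType) (m : nat) (a : fps R) (n : nat) :
  fpscoef (m%:R * a) n = m%:R * fpscoef a n.
Proof.
rewrite !mulr_natl; elim: m => [|m IHm]; first by rewrite !mulr0n.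
by rewrite !mulrS -IHm.
Qed.

(** Coefficientwise this is [catalan_pell_recS], and [catalan_pell0] in degree
    zero. *)
Lemma genfun_catalan_pell (d : nat) :
  (1 - 2%:R * fpsX - \sum_(1 <= k < d) (catalan k)%:R * fpsX ^+ k.+1)
    * genfun (catalan_pell d) = 1.
Proof.
apply: fpsP => n; rewrite !mulrBl mul1r mulr_suml -mulrA -{1}[fpsX]expr1.
pose S := genfun (catalan_pell d).
(* Extraction of a coefficient commutes with subtraction by computation. *)
rewrite -/S -[fpscoef (_ - _ - _) n]/(fpscoef S n
  - fpscoef (2%:R * (fpsX ^+ 1 * S)) n
  - fpscoef (\sum_(1 <= k < d) (catalan k)%:R * fpsX ^+ k.+1 * S) n).
rewrite fpscoef_sum.
under eq_bigr do rewrite -mulrA fpscoef_natMl fpscoefXnM.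
rewrite fpscoef_natMl fpscoefXnM.
case: n => [|n] /=.
  by rewrite catalan_pell0 mulr0 big1 ?subr0 // => k _; rewrite mulr0.
rewrite catalan_pell_recS subn1 /= PoszD PoszM ?natz.
apply/eqP; rewrite subr_eq0 addrAC subrr add0r -natz natr_sum big_mkcond /=.
apply/eqP; apply: eq_bigr => k _.
rewrite subSS ltnS; case: leqP => _; last by rewrite mulr0.
by rewrite natrM natz natz.
Qed.

Theorem mainTheorem3 (R : realType) :
  (forall d : nat,
     genfun (catalan_pell d) =
     (1 - 2%:R * fpsX
      - \sum_(1 <= k < d) (catalan k)%:R * fpsX ^+ k.+1)^-1) /\
  (forall n : nat, catalan_pell 1 n = (2 ^ n)%N) /\
  (forall n : nat, catalan_pell 2 n = pell n.+1) /\
  (forall n : nat,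
     (catalan_pell d n)%:R @[d --> \oo] --> ((catalan n.+1)%:R : R)).
Proof.
split; first by move=> d; rewrite (mulr1_eq (genfun_catalan_pell d)).
split=> [n|].
  elim: n => [|n IHn]; first by rewrite catalan_pell0.
  by rewrite catalan_pell_recS big_geq // addn0 IHn expnS.
split=> n.
  suff: catalan_pell 2 n = pell n.+1 /\ catalan_pell 2 n.+1 = pell n.+2.
    by case.
  elim: n => [|n [IHn IHn1]].
    by rewrite catalan_pell_recS catalan_pell0 big_mkcond big_nat1.
  split=> //; rewrite catalan_pell_recS big_mkcond big_nat1 /= subn1 IHn IHn1.
  by rewrite mul1n.
apply: cvg_near_cst; exists n => // d /= nd.
by rewrite catalan_pell_init.
Qed.
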